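(* Let $A\in\mathbb{R}^{n\times n}$ be diagonalizable with eigenvalues (counted with multiplicity) satisfying $|\lambda_1|>|\lambda_2|\ge\cdots\ge|\lambda_n|$, let $\beta>0$, and let $$A_\beta=\begin{pmatrix}A&-\beta I\\ I&0\end{pmatrix}\in\mathbb{R}^{2n\times 2n}.$$ Then the $2n$ (counting multiplicity) eigenvalues of $A_\beta$ are given by $$\mu_{\lambda_\pm}=\tfrac12\left(\lambda\pm\sqrt{\lambda^2-4\beta}\right),\qquad \lambda\in\{\lambda_1,\ldots,\lambda_n\}.$$ In the case that $\lambda^2-4\beta\ne0$, the eigenvectors of $A_\beta$ corresponding to each eigenvalue $\mu=\mu_{\lambda_\pm}$ are given by $$\psi_{\lambda_\pm}=\begin{pmatrix}\mu_{\lambda_\pm}\phi\\ \phi\end{pmatrix},$$ where $\phi$ is an eigenvector of $A$ corresponding to the eigenvalue $\lambda$. In the case that $\beta=\lambda^2/4>0$ for an eigenvalue $\lambda$ of $A$, the matrix $A_\beta$ is not diagonalizable. Moreover, if $\lambda$ is an eigenvalue of multiplicity $m$ of $A$, then the eigenvalue $\mu_\lambda=\lambda/2$ of $A_\beta$ has algebraic multiplicity $2m$ and geometric multiplicity $m$.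
   Context: Diagonalizability, eigenvalues and eigenvectors are understood over $\mathbb{C}$; $I$ is the $n\times n$ identity, and $\sqrt{\cdot}$ denotes either complex square root. *)

(* Defs.v *)
From mathcomp Require Import all_boot all_order all_algebra.
From mathcomp Require Import reals complex.

Set Implicit Arguments.
Unset Strict Implicit.
Unset Printing Implicit Defensive.

Import Order.TTheory GRing.Theory Num.Theory.
Local Open Scope ring_scope.
Local Open Scope complex_scope.

Definition complexify (R : realType) (p q : nat) (M : 'M[R]_(p, q)) :
    'M[R[i]]_(p, q) :=
  map_mx (real_complex R) M.

Definition Abeta (R : realType) (n : nat) (A : 'M[R]_n) (beta : R) :
    'M[R]_(n + n) :=
  block_mx A (- beta%:M) 1%:M 0.

(* Column convention; the library's [eigenspace] consists of row vectors. *)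
Definition eigenvector (K : fieldType) (n : nat) (M : 'M[K]_n) (a : K)
    (v : 'cV[K]_n) : Prop :=
  v != 0 /\ M *m v = a *: v.

Definition alg_mult (K : fieldType) (n : nat) (M : 'M[K]_n) (a : K) : nat :=
  mup a (char_poly M).

(* The rows of [eigenspace M^T a] span the transposes of the solutions [v]
   of [M *m v = a *: v]. *)
Definition geom_mult (K : fieldType) (n : nat) (M : 'M[K]_n) (a : K) : nat :=
  \rank (eigenspace M^T a).

(* [s] lists the eigenvalues of [M] counted with algebraic multiplicity:
   [alg_mult M a] is 0 exactly when [a] is not an eigenvalue. *)
Definition eigenvalues_with_mult (K : fieldType) (n : nat) (M : 'M[K]_n)
    (s : seq K) : Prop :=
  forall a : K, count_mem a s = alg_mult M a.

Definition mu_plus (R : realType) (sq : R[i] -> R[i]) (beta : R)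
    (lam : R[i]) : R[i] :=
  (lam + sq (lam ^+ 2 - 4%:R * beta%:C)) / 2%:R.

Definition mu_minus (R : realType) (sq : R[i] -> R[i]) (beta : R)
    (lam : R[i]) : R[i] :=
  (lam - sq (lam ^+ 2 - 4%:R * beta%:C)) / 2%:R.

(* Main.v *)
Require Import Defs.
From mathcomp Require Import all_boot all_order all_algebra.
From mathcomp Require Import reals complex ring.

Set Implicit Arguments.
Unset Strict Implicit.
Unset Printing Implicit Defensive.

Import Order.TTheory GRing.Theory Num.Theory.
Local Open Scope ring_scope.
Local Open Scope complex_scope.

(** Write [B] for the block matrix with rows [M], [-b] and [1], [0].  The second
block row of [B *m col_mx x y = mu *: col_mx x y] says [x = mu *: y], and the
first then becomes [mu *: (M *m y) = (mu ^+ 2 + b) *: y].  As [b] is nonzero, so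
is [mu], and [y] is an eigenvector of [M] for [l] as soon as
[mu ^+ 2 - l * mu + b = 0].  This settles the eigenvectors ([momentum_mx_eigen])
and shows that the eigenspaces of [B] at [mu] and of [M] at [l] have equal
dimension ([geom_mult_momentum]).

The same elimination of one block, carried out on ['X%:M - B], gives
[char_poly B = \det ('X^2 + b - 'X *: M)] ([char_poly_momentum]).  Diagonalizing
[M] turns this into the product of the quadratics ['X^2 - c *: 'X + b] over the
eigenvalues [c] of [M] with their multiplicities
([char_poly_momentum_spectrum]), and each quadratic splits with roots
[(c +- s) / 2], where [s ^+ 2 = c ^+ 2 - 4 b] ([momentum_roots]).

When [4 b = l ^+ 2], the number [l / 2] is a double root of the quadratic of [l]
and a root of no other one ([double_root_eq]), so its algebraic multiplicity in
[B] is twice that of [l] in [M].  Its geometric multiplicity is that of [l] in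
[M], which equals the algebraic one because [M] is diagonalizable
([geom_mult_diagonalizable]).  The same equality applied to [B] would yield
[m = 2 m] with [m > 0], so [B] is not diagonalizable. *)

(** * Diagonalizable matrices *)

Lemma rank_diag_mx (K : fieldType) (n : nat) (d : 'rV[K]_n) :
  \rank (diag_mx d) = #|[pred j | d 0 j != 0]|.
Proof.
have -> : #|[pred j | d 0 j != 0]| = (\sum_(j < n) (d 0%R j != 0%R))%N.
  rewrite -sum1_card big_mkcond.
  by apply: eq_bigr => j _; rewrite inE; case: eqP.
elim: n => [|n IHn] in d *; first by rewrite thinmx0 mxrank0 big_ord0.
rewrite -[n.+1]/(1 + n)%N in d *.
rewrite -[d]hsubmxK diag_mx_row rank_diag_block_mx IHn big_split_ord /=.
rewrite big_ord1 row_mxEl; congr (_ + _)%N; last first.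
  by apply: eq_bigr => j _; rewrite row_mxEr.
rewrite rank_rV; congr (nat_of_bool (~~ _)).
apply/eqP/eqP => [/matrixP/(_ 0 0)|l0]; first by rewrite !mxE eqxx.
by apply/matrixP => i j; rewrite !ord1 [LHS]mxE [RHS]mxE eqxx l0.
Qed.

Lemma diagonalizable_intertwine (K : fieldType) (n : nat) (M : 'M[K]_n) :
  diagonalizable M ->
  exists P : 'M[K]_n, exists2 d : 'rV[K]_n,
    P \in unitmx & P *m M = diag_mx d *m P.
Proof.
move=> [P Pu /diagonalizable_forPex[d /(simmxP Pu) PM]].
by exists P, d.
Qed.

(** Allowing arbitrary polynomials [a] and [b] covers two determinants at once:
['X%:M - M], the characteristic matrix of [M], and the quadratic pencil
[('X^2 + b)%:M - 'X *: M] of [char_poly_momentum]. *)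
Lemma det_pencil (K : fieldType) (n : nat) (M P : 'M[K]_n) (d : 'rV[K]_n)
    (a b : {poly K}) :
    P \in unitmx -> P *m M = diag_mx d *m P ->
  \det (a%:M - b *: map_mx polyC M) = \prod_(i < n) (a - b * (d 0 i)%:P).
Proof.
move=> Pu PM; pose Q := map_mx polyC P.
have Q0 : \det Q != 0.
  by rewrite det_map_mx polyC_eq0 -unitfE -unitmxE.
apply: (mulfI Q0); rewrite -det_mulmx mulmxBr -scalemxAr -map_mxM PM map_mxM.
rewrite scalemxAl scalar_mxC -mulmxBl det_mulmx mulrC; congr (_ * _).
rewrite map_diag_mx -diag_const_mx -linearZ -linearB det_diag.
by apply: eq_bigr => i _; rewrite !mxE.
Qed.

Lemma char_poly_intertwine (K : fieldType) (n : nat) (M P : 'M[K]_n)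
    (d : 'rV[K]_n) :
    P \in unitmx -> P *m M = diag_mx d *m P ->
  char_poly M = \prod_(c <- [seq d 0 i | i : 'I_n]) ('X - c%:P).
Proof.
move=> Pu PM; rewrite big_image /= /char_poly /char_poly_mx.
rewrite -[map_mx _ _]scale1r (det_pencil 'X 1 Pu PM).
by apply: eq_bigr => i _; rewrite mul1r.
Qed.

(** Conjugation preserves both multiplicities, and for a diagonal matrix each
counts the diagonal entries equal to [a]. *)
Lemma geom_mult_diagonalizable (K : fieldType) (n : nat) (M : 'M[K]_n)
    (a : K) :
  diagonalizable M -> geom_mult M a = alg_mult M a.
Proof.
move=> /diagonalizable_intertwine[P [d Pu PM]].
rewrite /alg_mult (char_poly_intertwine Pu PM) mu_prod_XsubC.
rewrite /geom_mult /eigenspace mxrank_ker -[a%:M]tr_scalar_mx -linearB.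
rewrite mxrank_tr.
have -> : \rank (M - a%:M) = \rank (diag_mx (d - const_mx a)).
  rewrite -(eqmxMfull (M - a%:M) (A := P)); last by rewrite row_full_unit.
  rewrite mulmxBr PM scalar_mxC -mulmxBl mxrankMfree ?row_free_unit//.
  by rewrite linearB /= diag_const_mx.
rewrite rank_diag_mx -sum1_count big_image_cond -{1}[n]card_ord.
rewrite -(cardC [pred j | (d - const_mx a) 0 j != 0]) addKn -sum1_card.
by apply: eq_bigl => i; rewrite !inE !mxE subr_eq0 negbK.
Qed.

(** * The momentum matrix *)

(** One step of the recurrence [x_(k+1) = M x_k - b x_(k-1)] (power iteration
with momentum), acting on the stacked pair of [x_k] and [x_(k-1)]. *)
Definition momentum_mx (K : fieldType) (n : nat) (M : 'M[K]_n) (b : K) :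
    'M[K]_(n + n) :=
  block_mx M (- b%:M) 1%:M 0.

Lemma complexify_Abeta (R : realType) (n : nat) (A : 'M[R]_n) (beta : R) :
  complexify (Abeta A beta) = momentum_mx (complexify A) beta%:C.
Proof.
by rewrite /complexify map_block_mx map_mxN !map_scalar_mx rmorph1 map_mx0.
Qed.

(** Multiplying the characteristic matrix on the right by the block lower
triangular matrix with rows ['X], [0] and [1], [1] clears its lower left block
and leaves the determinants of the quadratic pencil and of ['X%:M].  The
multiplier has determinant ['X^n], which cancels in [{poly K}]. *)
Lemma char_poly_momentum (K : fieldType) (n : nat) (M : 'M[K]_n) (b : K) :
  char_poly (momentum_mx M b) =
  \det (('X ^+ 2 + b%:P)%:M - 'X *: map_mx polyC M).
Proof.
have X0 : ('X : {poly K}) ^+ n != 0 by rewrite expf_neq0 ?polyX_eq0.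
apply: (mulIf X0).
(* The inserted factor [1] is the determinant of the multiplier's lower right
   block. *)
rewrite -[X in _ * X]mulr1 -{1}(det1 _ n) -det_scalar.
rewrite -(det_lblock ('X%:M) 1%:M 1%:M) -det_mulmx.
rewrite /char_poly_mx scalar_mx_block map_block_mx opp_block_mx add_block_mx.
rewrite mulmx_block map_mxN map_scalar_mx map_mx1 map_mx0 /=.
rewrite !mulmx0 !mulmx1 !subr0 !sub0r opprK !add0r mulNmx mul1mx addNr.
rewrite det_ublock; congr (\det _ * _).
rewrite mulmxBl mul_mx_scalar mul_mx_scalar scale_scalar_mx -expr2.
by rewrite raddfD addrAC.
Qed.

Lemma char_poly_momentum_spectrum (K : fieldType) (n : nat) (M : 'M[K]_n)
    (b : K) (s : seq K) :
    diagonalizable M -> eigenvalues_with_mult M s ->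
  char_poly (momentum_mx M b) = \prod_(c <- s) ('X ^+ 2 + b%:P - 'X * c%:P).
Proof.
move=> /diagonalizable_intertwine[P [d Pu PM]] s_eig.
rewrite char_poly_momentum (det_pencil _ _ Pu PM).
have s_d : perm_eq s [seq d 0 i | i : 'I_n].
  apply/allP => a _ /=; apply/eqP.
  by rewrite s_eig /alg_mult (char_poly_intertwine Pu PM) mu_prod_XsubC.
by rewrite (perm_big _ s_d) big_image.
Qed.

(** Stated for matrices with [p] columns so that it applies both to single
vectors and to a whole eigenspace. *)
Lemma momentum_mx_eigen (K : fieldType) (n p : nat) (M : 'M[K]_n)
    (b l mu : K) (x y : 'M[K]_(n, p)) :
    b != 0 -> mu ^+ 2 - l * mu + b = 0 ->
  momentum_mx M b *m col_mx x y = mu *: col_mx x y <->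
  x = mu *: y /\ M *m y = l *: y.
Proof.
move=> b0 mu_root.
have mu0 : mu != 0.
  by apply: contraNneq b0 => mu0; rewrite -mu_root mu0 expr0n mulr0 subr0 add0r.
have muE : mu * l = mu * mu + b.
  by apply/eqP; rewrite eq_sym -subr_eq0 -mu_root; apply/eqP; ring.
rewrite mul_block_col scale_col_mx mul1mx mul0mx addr0 mulNmx mul_scalar_mx.
split=> [/eq_col_mx[My xE]|[-> My]].
  split=> //; apply: (scalerI mu0).
  rewrite xE -scalemxAr !scalerA in My.
  have -> : mu *: (M *m y) = (mu * mu + b) *: y.
    by rewrite scalerDl -My subrK.
  by rewrite scalerA -muE.
rewrite -scalemxAr My !scalerA -scalerBl; congr (col_mx (_ *: _) _).
by rewrite muE addrK.
Qed.

(** Right multiplication by [row_mx mu%:M 1%:M], the transposed form of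
[y |-> col_mx (mu *: y) y], is injective and carries the eigenspace of [M^T]
onto that of [(momentum_mx M b)^T]. *)
Lemma geom_mult_momentum (K : fieldType) (n : nat) (M : 'M[K]_n)
    (b l mu : K) :
    b != 0 -> mu ^+ 2 - l * mu + b = 0 ->
  geom_mult (momentum_mx M b) mu = geom_mult M l.
Proof.
move=> b0 mu_root; pose J : 'M[K]_(n, n + n) := row_mx mu%:M 1%:M.
have Jfree : row_free J.
  apply/row_freeP; exists (col_mx 0 1%:M).
  by rewrite mul_row_col mulmx0 add0r mulmx1.
have trJ p (y : 'M[K]_(n, p)) : (y^T *m J)^T = col_mx (mu *: y) y.
  rewrite trmx_mul trmxK tr_row_mx tr_scalar_mx trmx1 mul_col_mx.
  by rewrite !mul_scalar_mx scale1r.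
rewrite /geom_mult -(mxrankMfree (eigenspace M^T l) Jfree).
apply/eqP; rewrite eqn_leq !mxrankS //.
  apply/eigenspaceP; apply: trmx_inj.
  rewrite linearZ /= trmx_mul trmxK -[eigenspace M^T l]trmxK trJ.
  apply/(momentum_mx_eigen _ _ _ b0 mu_root); split=> //.
  have /(congr1 trmx) : eigenspace M^T l *m M^T = l *: eigenspace M^T l.
    exact/eigenspaceP.
  by rewrite trmx_mul trmxK linearZ.
set U := eigenspace (momentum_mx M b)^T mu.
have /(congr1 trmx) : U *m (momentum_mx M b)^T = mu *: U by exact/eigenspaceP.
rewrite trmx_mul trmxK linearZ /= -[U^T]vsubmxK.
set x := usubmx _; set y := dsubmx _ => BU.
have [xE My] := (momentum_mx_eigen M x y b0 mu_root).1 BU.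
have -> : U = y^T *m J by apply: trmx_inj; rewrite trJ -xE vsubmxK.
apply: submxMr; apply/eigenspaceP.
by rewrite -trmx_mul My linearZ.
Qed.

(** * The quadratic attached to an eigenvalue *)

Lemma momentum_roots (K : fieldType) (s l b : K) :
    2%:R != 0 :> K -> s ^+ 2 = l ^+ 2 - 4%:R * b ->
  'X ^+ 2 + b%:P - 'X * l%:P =
  ('X - ((l + s) / 2%:R)%:P) * ('X - ((l - s) / 2%:R)%:P).
Proof.
move=> two0 sE; set p := (l + s) / 2%:R; set q := (l - s) / 2%:R.
have lE : l = p + q by rewrite /p /q; field.
have bE : b = p * q.
  have four0 : 4%:R != 0 :> K by rewrite (natrM _ 2 2) mulf_neq0.
  apply: (mulfI four0); have -> : 4%:R * (p * q) = l ^+ 2 - s ^+ 2.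
    by rewrite /p /q; field.
  by rewrite sE; ring.
rewrite {1}lE bE polyCD polyCM; ring.
Qed.

Lemma momentum_root_eq (K : fieldType) (s l b mu : K) :
    2%:R != 0 :> K -> s ^+ 2 = l ^+ 2 - 4%:R * b ->
    mu = (l + s) / 2%:R \/ mu = (l - s) / 2%:R ->
  mu ^+ 2 - l * mu + b = 0.
Proof.
move=> two0 /(momentum_roots two0)/(congr1 (horner^~ mu)) E mu_pm.
have -> : mu ^+ 2 - l * mu + b = mu ^+ 2 + b - mu * l by ring.
move: E; rewrite !hornerE => ->.
by case: mu_pm => <-; rewrite subrr ?mul0r ?mulr0.
Qed.

(** If [l / 2] is also a root of the quadratic of [c], then
[c = l / 2 + b / (l / 2) = l], because the root determines the middle
coefficient. *)
Lemma double_root_eq (K : fieldType) (s c l b : K) :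
    2%:R != 0 :> K -> l != 0 -> 4%:R * b = l ^+ 2 ->
    s ^+ 2 = c ^+ 2 - 4%:R * b ->
  ((c + s) / 2%:R == l / 2%:R) = (c == l).
Proof.
move=> two0 l0 bE sE; apply/eqP/eqP => [/(mulIf (invr_neq0 two0)) csl|cl].
  apply/eqP; rewrite eq_sym -subr_eq0; apply/eqP.
  apply: (mulfI (mulf_neq0 two0 l0)).
  have -> : 2%:R * l * (l - c) = (l - c) ^+ 2 - (c ^+ 2 - l ^+ 2) by ring.
  by rewrite -bE -sE -csl; ring.
move: sE; rewrite cl bE subrr => /eqP; rewrite sqrf_eq0 => /eqP ->.
by rewrite addr0.
Qed.

Lemma eigenvalue_alg_mult (K : fieldType) (n : nat) (M : 'M[K]_n) (l : K) :
  eigenvalue M l -> (0 < alg_mult M l)%N.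
Proof.
rewrite eigenvalue_root_char -dvdp_XsubCl.
by rewrite XsubC_dvd // monic_neq0 // char_poly_monic.
Qed.

(** * Spectrum of the momentum matrix *)

Theorem proposition2p1 (R : realType) (n : nat) (A : 'M[R]_n.+1)
    (lam : 'I_n.+1 -> R[i]) (beta : R) (sq : R[i] -> R[i])
    (A_diag : diagonalizable (complexify A))
    (lam_eig : eigenvalues_with_mult (complexify A) [seq lam i | i : 'I_n.+1])
    (lam_dom : forall i : 'I_n.+1, i != ord0 -> `|lam i| < `|lam ord0|)
    (lam_ord : forall i j : 'I_n.+1, (i <= j)%N -> `|lam j| <= `|lam i|)
    (beta_gt0 : 0 < beta)
    (sqP : forall z : R[i], sq z ^+ 2 = z) :
  [/\ eigenvalues_with_mult (complexify (Abeta A beta))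
        ([seq mu_plus sq beta (lam i) | i : 'I_n.+1] ++
         [seq mu_minus sq beta (lam i) | i : 'I_n.+1]),
      forall l mu : R[i],
        eigenvalue (complexify A) l ->
        l ^+ 2 - 4%:R * beta%:C != 0 ->
        mu = mu_plus sq beta l \/ mu = mu_minus sq beta l ->
        forall psi : 'cV[R[i]]_(n.+1 + n.+1),
          eigenvector (complexify (Abeta A beta)) mu psi <->
          exists2 phi : 'cV[R[i]]_n.+1,
            eigenvector (complexify A) l phi & psi = col_mx (mu *: phi) phi
    & forall l : R[i],
        eigenvalue (complexify A) l ->
        beta%:C = l ^+ 2 / 4%:R ->
        ~ diagonalizable (complexify (Abeta A beta)) /\
        (forall m : nat, alg_mult (complexify A) l = m ->
           alg_mult (complexify (Abeta A beta)) (l / 2%:R) = (2 * m)%N /\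
           geom_mult (complexify (Abeta A beta)) (l / 2%:R) = m)].
Proof.
rewrite complexify_Abeta; set M := complexify A in A_diag lam_eig *.
have two0 : 2%:R != 0 :> R[i] by rewrite pnatr_eq0.
have b0 : beta%:C != 0 :> R[i].
  by rewrite (inj_eq (@complexI R) beta 0) gt_eqF.
pose s := [seq lam i | i : 'I_n.+1].
have sE : [seq mu_plus sq beta (lam i) | i : 'I_n.+1] ++
    [seq mu_minus sq beta (lam i) | i : 'I_n.+1] =
    map (mu_plus sq beta) s ++ map (mu_minus sq beta) s.
  by rewrite /s /image_mem -!(map_comp _ lam).
have eigs : eigenvalues_with_mult (momentum_mx M beta%:C)
    ([seq mu_plus sq beta (lam i) | i : 'I_n.+1] ++
     [seq mu_minus sq beta (lam i) | i : 'I_n.+1]).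
  move=> a; rewrite sE /alg_mult (char_poly_momentum_spectrum _ A_diag lam_eig).
  under eq_bigr => c _ do rewrite (momentum_roots two0 (sqP _)).
  by rewrite big_split /= -(mu_prod_XsubC a) big_cat !big_map.
split=> //.
  move=> l mu _ _ mu_pm psi.
  have mu_root := momentum_root_eq two0 (sqP _) mu_pm.
  have eqv x y := momentum_mx_eigen M x y b0 mu_root.
  split=> [[psi0]|[phi [phi0 Mphi] ->]].
    rewrite -[psi]vsubmxK in psi0 * => /eqv[xE My].
    exists (dsubmx psi); last by rewrite -xE.
    split=> //; apply: contraNneq psi0 => y0.
    by rewrite xE y0 scaler0 col_mx0.
  split; last exact/eqv.
  by rewrite col_mx_eq0 negb_and phi0 orbT.
move=> l l_eig bE.
have bl : 4%:R * beta%:C = l ^+ 2.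
  by rewrite bE mulrC divfK ?pnatr_eq0.
have disc0 : l ^+ 2 - 4%:R * beta%:C = 0 by rewrite bl subrr.
have sq0 : sq (l ^+ 2 - 4%:R * beta%:C) = 0.
  by apply/eqP; rewrite -sqrf_eq0 sqP disc0.
have mu_root : (l / 2%:R) ^+ 2 - l * (l / 2%:R) + beta%:C = 0.
  by apply: (momentum_root_eq two0 (sqP _)); left; rewrite sq0 addr0.
have geom : geom_mult (momentum_mx M beta%:C) (l / 2%:R) = alg_mult M l.
  by rewrite (geom_mult_momentum _ b0 mu_root) geom_mult_diagonalizable.
have alg : alg_mult (momentum_mx M beta%:C) (l / 2%:R) = (2 * alg_mult M l)%N.
  have l0 : l != 0.
    by apply: contraNneq b0 => l0; rewrite bE l0 expr0n mul0r.
  rewrite -eigs -lam_eig sE count_cat !count_map mul2n -addnn.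
  congr (_ + _)%N; apply: eq_count => c /=.
    by rewrite (double_root_eq two0 l0 bl (sqP _)).
  (* The minus root is the plus root for the square root [- sq _]. *)
  by rewrite (double_root_eq two0 l0 bl) // sqrrN.
split=> [B_diag|m <- //].
have := geom_mult_diagonalizable (l / 2%:R) B_diag.
rewrite geom alg => m2; have := eigenvalue_alg_mult l_eig.
by rewrite -(ltn_add2l (alg_mult M l)) addn0 addnn -mul2n -m2 ltnn.
Qed.
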